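(* Let $F\in\mathcal{L}_1(S)$ and let $Q$ be a large orbit of $F$ (that is, a true periodic orbit of $F$ with $\mathrm{diam}(\mathrm{Re}(Q))\ge1$) such that $Q$ lives in the branches (that is, $Q\subset B$). Then $\mathrm{Per}(F)=\mathbb{N}$.
   Context: $\mathbb{N}=\{1,2,3,\dots\}$. $S=\mathbb{R}\cup B\subset\mathbb{C}$, where $B=\{z\in\mathbb{C}:\mathrm{Re}(z)\in\mathbb{Z},\ \mathrm{Im}(z)\in[0,1]\}$ is the set of branches and $\mathbb{R}$ is the real axis. $\mathcal{L}_1(S)$ is the set of continuous maps $F:S\to S$ with $F(z+1)=F(z)+1$ for all $z\in S$. A true periodic orbit of $F$ is a set $\{F^n(z):n\ge0\}$ where $F^k(z)=z$ for some $k\in\mathbb{N}$. A point $z\in S$ is periodic (mod 1) for $F$ if $F^n(z)\in z+\mathbb{Z}$ for some $n\in\mathbb{N}$; the least such $n$ is its period (mod 1). $\mathrm{Per}(F)$ is the set of periods (mod 1) of all periodic (mod 1) points of $F$. *)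

(* Defs.v *)
From HB Require Import structures.
From mathcomp Require Import all_boot all_order all_algebra complex.
From mathcomp Require Import all_classical all_reals all_analysis.

Set Implicit Arguments.
Unset Strict Implicit.
Unset Printing Implicit Defensive.

Import Order.TTheory GRing.Theory Num.Theory numFieldNormedType.Exports.

Local Open Scope classical_set_scope.
Local Open Scope ring_scope.

(* [R[i]] packaged as a [numClosedFieldType]: this is what gives it its usual
   metric topology (the one of the modulus) through
   [numFieldNormedType.Exports]; the bare type [R[i]] is not recognized as a
   topological space by the [{within _, continuous _}] notation. *)
Definition C (R : realType) : numClosedFieldType := complex R.

(* [Re] and [Im] with values in [R]; the library's ['Re] and ['Im] have their
   values in the complex field itself. *)
Definition re (R : realType) (z : C R) : R := complex.Re z.
Definition im (R : realType) (z : C R) : R := complex.Im z.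

Definition real_axis (R : realType) : set (C R) := [set z | im z = 0].

Definition branches (R : realType) : set (C R) :=
  [set z | re z \is a Num.int /\ 0 <= im z <= 1].

Definition branched_line (R : realType) : set (C R) :=
  @real_axis R `|` @branches R.

(* A self-map of [branched_line] is represented by a function on the whole
   plane; its values outside [branched_line] are irrelevant to all the notions
   below. *)
Definition L1 (R : realType) : set (C R -> C R) :=
  [set F | [/\ forall z, branched_line z -> branched_line (F z),
               {within @branched_line R, continuous F} &
               forall z, branched_line z -> F (z + 1) = F z + 1]].

Definition forward_orbit (R : realType) (F : C R -> C R) (z : C R) : set (C R) :=
  range (fun n : nat => iter n F z).

Definition true_periodic_orbit (R : realType) (F : C R -> C R)
    (Q : set (C R)) : Prop :=
  exists z, [/\ branched_line z, exists2 k : nat, (0 < k)%N & iter k F z = z &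
                Q = forward_orbit F z].

Definition diam (R : realType) (A : set R) : \bar R :=
  ereal_sup [set (`|x - y|)%:E | x in A & y in A].

Definition large_orbit (R : realType) (F : C R -> C R) (Q : set (C R)) : Prop :=
  true_periodic_orbit F Q /\ (1 <= diam (@re R @` Q))%E.

Definition returns_mod1 (R : realType) (F : C R -> C R) (z : C R) (n : nat) :
    Prop :=
  (0 < n)%N /\ exists m : int, iter n F z = z + m%:~R.

Definition period_mod1 (R : realType) (F : C R -> C R) (z : C R) (n : nat) :
    Prop :=
  returns_mod1 F z n /\ forall k : nat, returns_mod1 F z k -> (n <= k)%N.

Definition Per (R : realType) (F : C R -> C R) : set nat :=
  [set n | exists2 z, branched_line z & period_mod1 F z n].

(* Main.v *)
Require Import Defs.
From HB Require Import structures.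
From mathcomp Require Import all_boot all_order all_algebra complex.
From mathcomp Require Import all_classical all_reals all_analysis.
From mathcomp Require Import ring lra.
Import Order.TTheory GRing.Theory Num.Theory numFieldNormedType.Exports.
Local Open Scope classical_set_scope.
Local Open Scope ring_scope.

(** The orbit [Q] meets the branches in points [m_n + i x_n] with integers
    [m_n]. By equivariance [F (i x_n) = d_n + i x_(n+1)], where
    [d_n = m_(n+1) - m_n]. The orbit is closed and meets two different branches,
    so the [d_n] sum to zero over a period without all vanishing; hence they are
    not all equal. Comparing the lowest point of the orbit with the lowest point
    whose [d_n] is different gives heights [s < c] such that [F (i s)] lies on
    some branch [d] at height at least [c], while [F (i c)] lies on another
    branch ([crossing_index], [large_orbit_crossing]). Composing with an
    integer translation does not change the periods mod 1, so [F] may be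
    replaced by [G = F - d] ([Per_translate]).

    Now follow [G (i t)] from [t = s] to [t = c]. It starts on branch 0, at
    height at least [c], and leaves this branch through its root. Stop at a
    suitable earlier time, still called [c], at which [G (i c)] is one of the
    roots 0, 1, -1. Then [G (G (i c))] is [G 0] or [G 0 +- 1], and the root can
    be chosen so that this point is not on branch 0 above the root: take
    the root 0 if [G 0] is not there either, and the first root among 1 and -1
    that is reached if [G 0] is there ([Per_of_crossing]).

    Let [y] be the last time in [[s, c]] with [G (i y) = i s]. Along branch 0,
    the map [G] stretches [[s, y]] over [[s, c]]: one end goes to height at
    least [c] and the other to [s]. Its square stretches [[y, c]] over [[s, c]]:
    one end goes to [G (i s)], the other away from the branch or to its root.
    Hence for every [n >= 2] the itinerary that starts in [[y, c]], jumps by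
    [G^2] to [[s, y]], stays there for [n - 2] steps and comes back to its
    starting point is realized ([loop_through]). An earlier return would have to
    be at [y], the only common point of the two intervals, but [G^2] sends
    [i y] too high. For [n = 2] the point is not fixed by [G] because beyond [y]
    the image stays below height [s]. A fixed point in [[s, y]] takes care of
    [n = 1] ([Per_of_stretched_segment]).

    The intermediate value theorem is applied to real functions only. This is
    the purpose of [height], a continuous function on the plane that equals the
    imaginary part on branch 0 and is negative on the rest of the branched line,
    so that a nonnegative height determines the point. *)

Set Implicit Arguments.
Unset Strict Implicit.

(** * Intervals stretched by continuous real functions *)

(** The points [p] and [q] may come in either order, and only their membership
    in [[a, b]] is remembered: this is the form in which stretching is used. *)
Lemma ivt (R : realType) (f : R -> R) (a b p q v : R) :
    continuous f -> a <= p <= b -> a <= q <= b -> f p <= v -> v <= f q ->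
  exists2 t, a <= t <= b & f t = v.
Proof.
move=> cf /andP[ap pb] /andP[aq qb] fp fq.
wlog pq : f p q v cf ap pb aq qb fp fq / p <= q.
  move=> H; case: (leP p q) => [|/ltW qp]; first exact: (H f p q v).
  have [|||t tab tE] := H (fun t => - f t) q p (- v) _ aq qb ap pb _ _ qp.
  - by move=> x; apply: cvgN; exact: cf.
  - by rewrite lerN2.
  - by rewrite lerN2.
  - by exists t => //; apply: oppr_inj.
have [||t] := @IVT R f p q v pq.
- exact: continuous_subspaceT.
- by rewrite ge_min fp le_max fq orbT.
by rewrite in_itv /= => tpq <-; exists t => //; lra.
Qed.

Lemma first_hit (R : realType) (f : R -> R) (a b v : R) :
    continuous f -> a <= b -> f a <= v -> v <= f b ->
  exists y, [/\ a <= y <= b, f y = v & forall t, a <= t < y -> f t < v].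
Proof.
move=> cf ab fa fb.
(* The hitting time is the least element of the compact set where [v <= f]. *)
pose A := `[a, b]%classic `&` f @^-1` [set x | v <= x].
have [||//|y + ymin] := @compact_EVT_min _ R id A.
- by exists b; split => //=; rewrite in_itv /=; lra.
- apply: (@subclosed_compact _ _ `[a, b]%classic); last by move=> t [].
  + apply: closedI; first exact: itv_closed.
    by apply: preimage_closed; [move=> t _; exact: cf|exact: closed_ge].
  + exact: segment_compact.
- by apply: continuous_subspaceT => x; exact: cvg_id.
rewrite inE /A /= in_itv /= => -[yab fy].
have [||||t tay ft] := @ivt R f a y a y v cf; [lra|lra|by []|by []|].
have yt : y <= t.
  by apply: ymin; rewrite inE /A /= in_itv /= ft; split => //; lra.
have yE : y = t by lra.
exists t; split => //; first by lra.
move=> x xat; rewrite ltNge; apply/negP => fx.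
have : y <= x by apply: ymin; rewrite inE /A /= in_itv /=; split => //; lra.
by lra.
Qed.

Lemma last_hit (R : realType) (f : R -> R) (a b v : R) :
    continuous f -> a <= b -> f a <= v -> v <= f b ->
  exists y, [/\ a <= y <= b, f y = v & forall t, y < t <= b -> v < f t].
Proof.
move=> cf ab fa fb.
have [|||| y [yab fy ylast]] :=
    @first_hit R (fun t => - f (- t)) (- b) (- a) (- v); rewrite ?opprK; try lra.
  move=> x; apply: cvgN; apply: (@continuous_comp _ _ _ -%R f); last exact: cf.
  exact: opp_continuous.
exists (- y); split; [by lra|by apply: oppr_inj|].
by move=> t ty; have := ylast (- t); rewrite opprK; lra.
Qed.

(** The values [u] and [v] need not be taken at the ends of [[a, b]], which
    spares any discussion of orientation. *)
Definition maps_onto (R : realType) (f : R -> R) (a b u v : R) :=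
  [/\ forall t, a <= t <= b -> u <= f t <= v,
      exists2 p, a <= p <= b & f p = u &
      exists2 q, a <= q <= b & f q = v].

(** Cutting at the last time at which [f] is still at [u], and then at the first
    time at which it reaches [v], keeps the values between [u] and [v]. *)
Lemma onto_subinterval (R : realType) (f : R -> R) (a b u v p q : R) :
    continuous f -> u <= v -> a <= p <= b -> a <= q <= b ->
    f p <= u -> v <= f q ->
  exists a' b', [/\ a <= a', b' <= b & maps_onto f a' b' u v].
Proof.
move=> cf uv /andP[ap pb] /andP[aq qb] fp fq.
wlog pq : f a b p q cf ap pb aq qb fp fq / p <= q.
  move=> H; case: (leP p q) => [|/ltW qp]; first exact: (H f a b p q).
  have [|||||||| a' [b' [aa' bb' [im [x xin fx] [z zin fz]]]]] :=
     H (fun t => f (- t)) (- b) (- a) (- p) (- q); rewrite ?opprK; try lra.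
    move=> x; apply: (@continuous_comp _ _ _ -%R f); last exact: cf.
    exact: opp_continuous.
  exists (- b'), (- a'); split; [lra|lra|split].
  - by move=> t tin; have := im (- t); rewrite opprK; apply; lra.
  - by exists (- x) => //; lra.
  - by exists (- z) => //; lra.
have [|a' [a'in fa' a'last]] := @last_hit R f p q u cf pq fp; first by lra.
have [|||b' [b'in fb' b'first]] := @first_hit R f a' q v cf; [lra|lra|by []|].
exists a', b'; split; [lra|lra|split; last 2 first].
- by exists a' => //; lra.
- by exists b' => //; lra.
move=> t tin; apply/andP; split.
- have [->|ta'] := eqVneq t a'; first by rewrite fa'.
  by apply/ltW/a'last; lra.
- have [->|tb'] := eqVneq t b'; first by rewrite fb'.
  by apply/ltW/b'first; lra.
Qed.

Lemma maps_onto_comp (R : realType) (f g : R -> R) (a b p q u v : R) :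
    continuous f -> maps_onto f a b p q -> maps_onto g p q u v ->
  maps_onto (g \o f) a b u v.
Proof.
move=> cf [fim [x xin fx] [z zin fz]] [gim [x' x'in gx'] [z' z'in gz']].
split.
- by move=> t tin; apply/gim/fim.
- have [||t tin ft] := @ivt R f a b x z x' cf xin zin; [lra|lra|].
  by exists t => //=; rewrite ft.
- have [||t tin ft] := @ivt R f a b x z z' cf xin zin; [lra|lra|].
  by exists t => //=; rewrite ft.
Qed.

(** As [f] stretches [[s, y]] over [[s, c]], any interval inside [[s, c]] can be
    pulled back into [[s, y]], as often as desired. *)
Lemma iter_onto (R : realType) (f : R -> R) (s y c : R) (m : nat) :
    continuous f -> s <= y <= c -> c <= f s -> f y <= s ->
  exists p q, [/\ s <= p, q <= c, p <= q, maps_onto (iter m f) p q y c &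
    forall t k, p <= t <= q -> (k < m)%N -> s <= iter k f t <= y].
Proof.
move=> cf syc fs fy; elim: m => [|m [p [q [sp qc pq fonto fin]]]].
  by exists y, c; split; [lra|lra|lra|split => //=; [exists y|exists c] => //; lra|].
have [|||||p' [q' [sp' q'y onto]]] :=
  @onto_subinterval R f s y p q y s cf; try lra.
have [fim [x xin _] _] := onto.
exists p', q'; split; try lra.
  have := maps_onto_comp cf onto fonto; congr maps_onto.
  by apply/funext => t; rewrite iterSr.
move=> t [|k] tin km; first by rewrite /=; lra.
by rewrite iterSr; apply: fin => //; exact: fim.
Qed.

(** The interval [[y, c]] is stretched by [g] over the interval of points which
    [f] brings back onto [[y, c]] after [m] steps inside [[s, y]]. A map of an
    interval onto a larger one has a fixed point. *)
Lemma loop_through (R : realType) (f g : R -> R) (s y c : R) (m : nat) :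
    continuous f -> continuous g -> s <= y <= c ->
    c <= f s -> f y <= s -> c <= g y -> g c <= s ->
  exists t, [/\ y <= t <= c, iter m f (g t) = t &
    forall k, (k < m)%N -> s <= iter k f (g t) <= y].
Proof.
move=> cf cg syc fs fy gy gc.
have [p [q [sp qc pq fonto fin]]] := iter_onto m cf syc fs fy.
have [|||||a [b [ya bc gonto]]] := @onto_subinterval R g y c p q c y cg; try lra.
have [_ [x xin xE] [z zin zE]] := maps_onto_comp cg gonto fonto.
have cm : continuous (iter m f).
  elim: (m) => [|k IH] u; first exact: cvg_id.
  by apply: (@continuous_comp _ _ _ (iter k f) f); [exact: IH|exact: cf].
have [|||t tin tE] := @ivt R (fun t => iter m f (g t) - t) a b x z 0 _ xin zin.
- move=> u; apply: cvgB; last exact: cvg_id.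
  by apply: (@continuous_comp _ _ _ g (iter m f)); [exact: cg|exact: cm].
- by move: xE => /= ->; lra.
- by move: zE => /= ->; lra.
exists t; split; [lra|lra|].
by move=> k km; apply: fin => //; case: gonto => + _ _; apply.
Qed.

(** * Coordinates on the branched line *)

Definition branch_pt (R : realType) (t : R) : C R := Complex 0 t.

(** On the branched line this vanishes exactly on branch 0, is the distance to 0
    on the real axis, and is at least 1 on all other branches. The factor
    [1 + im z] makes the value 1 exclude the points of the branches 1 and -1
    above their roots. *)
Definition offset (R : realType) (z : C R) : R := `|re z| * (1 + im z).

(** On the branched line, a height on branch 0 that goes on with negative values
    everywhere outside this branch. *)
Definition height (R : realType) (z : C R) : R := im z - offset z.

(** Real functions defined along branch 0 are extended by constants to the whole
    line, so that continuity is never relative to a subset. *)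
Definition clamp (R : realType) (t : R) : R := Num.max 0 (Num.min t 1).

Lemma re_im_eq (R : realType) (z w : C R) : re z = re w -> im z = im w -> z = w.
Proof. by case: z w => [a b] [c d]; rewrite /re /im /= => -> ->. Qed.

Lemma intC (R : realType) (m : int) : (m%:~R : C R) = Complex m%:~R 0.
Proof. by rewrite -(rmorph_int (real_complex R)). Qed.

Lemma reDz (R : realType) (z : C R) (m : int) : re (z + m%:~R) = re z + m%:~R.
Proof. by rewrite intC; case: z. Qed.

Lemma imDz (R : realType) (z : C R) (m : int) : im (z + m%:~R) = im z.
Proof. by rewrite intC; case: z => a b; rewrite /im /= addr0. Qed.

Lemma re_continuous (R : realType) : continuous (@re R).
Proof.
move=> z; apply/(@cvgrPdist_lt R R _ _ (nbhs_filter z) (@re R) _) => e e0.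
near=> w.
have zw : `|z - w| < (e%:C)%C.
  by near: w; apply: cvgr_dist_lt; [exact: cvg_id|rewrite ltcR].
rewrite -ltcR; apply: le_lt_trans zw.
by have := normc_ge_Re (z - w); case: (z) (w) => [a b] [c d].
Unshelve. all: by end_near. Qed.

Lemma im_continuous (R : realType) : continuous (@im R).
Proof.
move=> z; apply/(@cvgrPdist_lt R R _ _ (nbhs_filter z) (@im R) _) => e e0.
near=> w.
have zw : `|z - w| < (e%:C)%C.
  by near: w; apply: cvgr_dist_lt; [exact: cvg_id|rewrite ltcR].
rewrite -ltcR; apply: le_lt_trans zw.
(* Multiplication by [i] turns the bound on real parts into one on imaginary
   parts. *)
have := normc_ge_Re ((z - w) * 'i%C); rewrite normrM.
have -> : `|'i%C : C R| = 1 by rewrite normc_def /= expr0n expr1n add0r sqrtr1.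
by rewrite mulr1 ReiNIm normrN; case: (z) (w) => [a b] [c d].
Unshelve. all: by end_near. Qed.

Lemma branch_pt_continuous (R : realType) : continuous (@branch_pt R).
Proof.
move=> t; apply/(@cvgrPdist_lt (C R) (C R) _ _ (nbhs_filter t) (@branch_pt R) _).
move=> -[e e'] /[dup] + e0.
rewrite ltcE /= => /andP[/eqP e'0 e0']; near=> u.
rewrite normc_def ltcE /= e'0 eqxx /= subr0 expr0n add0r sqrtr_sqr.
by near: u; exact: (@cvgr_dist_lt R R _ _ (nbhs_filter t) id t (@cvg_id _ _) _ e0').
Unshelve. all: by end_near. Qed.

Lemma offset_continuous (R : realType) : continuous (@offset R).
Proof.
move=> z; apply: (@cvgM R _ _ (nbhs_filter z) (fun z => `|re z|)
  (fun z => 1 + im z)).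
  by apply: (@cvg_norm _ R^o _ _ (nbhs_filter z) (@re R)); exact: re_continuous.
apply: (@cvgD R R _ _ (nbhs_filter z) (cst 1) (@im R)); first exact: cvg_cst.
exact: im_continuous.
Qed.

Lemma height_continuous (R : realType) : continuous (@height R).
Proof.
move=> z; apply: (@cvgB R R _ _ (nbhs_filter z) (@im R) (@offset R)).
  exact: im_continuous.
exact: offset_continuous.
Qed.

Lemma clamp_continuous (R : realType) : continuous (@clamp R).
Proof.
move=> t; apply: (@continuous_max R R (fun=> 0) (fun t => Num.min t 1)).
  exact: cvg_cst.
by apply: (@continuous_min R R id (fun=> 1)); [exact: cvg_id|exact: cvg_cst].
Qed.

Lemma clampE (R : realType) (t : R) : 0 <= t <= 1 -> clamp t = t.
Proof.
by move=> /andP[t0 t1]; rewrite /clamp (min_idPl t1) (max_idPr t0).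
Qed.

Lemma clamp_in (R : realType) (t : R) : 0 <= clamp t <= 1.
Proof.
by rewrite /clamp le_max lexx ge_max ler01 ge_min lexx orbT.
Qed.

Lemma branch_pt_clamp_continuous (R : realType) :
  continuous (fun t : R => branch_pt (clamp t)).
Proof.
move=> t; apply: (@continuous_comp _ _ _ (@clamp R) (@branch_pt R)).
  exact: clamp_continuous.
exact: branch_pt_continuous.
Qed.

Lemma branch_pt_in (R : realType) (t : R) :
  0 <= t <= 1 -> branched_line (branch_pt t).
Proof. by move=> t01; right; split => //; exact: rpred0. Qed.

Lemma branch_pt_clamp_in (R : realType) (t : R) :
  branched_line (branch_pt (clamp t)).
Proof. exact/branch_pt_in/clamp_in. Qed.

Lemma branched_lineD (R : realType) (z : C R) (m : int) :
  branched_line z -> branched_line (z + m%:~R).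
Proof.
case=> [z0|[rez imz]]; first by left; rewrite /real_axis /= imDz.
by right; split; rewrite ?reDz ?imDz// rpredD// intr_int.
Qed.

Lemma branched_im (R : realType) (z : C R) : branched_line z -> 0 <= im z <= 1.
Proof. by case=> [/= ->|[]//]; rewrite lexx ler01. Qed.

Lemma branched_cases (R : realType) (z : C R) : branched_line z ->
  [\/ im z = 0, re z = 0 | 1 <= `|re z|].
Proof.
case=> [|[rez _]]; first by constructor 1.
have [re0|re0] := eqVneq (re z) 0; first by constructor 2.
by constructor 3; rewrite norm_intr_ge1.
Qed.

(** At height [h] of another branch [k], the value is [h (1 - |k|) - |k| < 0]; on
    the real axis it is [- |re z|]. *)
Lemma height_ge0 (R : realType) (z : C R) : branched_line z ->
  0 <= height z -> z = branch_pt (height z).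
Proof.
move=> zS rz; suff re0 : re z = 0.
  by apply: re_im_eq; rewrite // /height /offset re0 normr0 mul0r subr0.
have := branched_im zS; move: rz; rewrite /height /offset => rz iz.
have [im0|//|re1] := branched_cases zS.
  by apply/eqP; rewrite -normr_le0; move: rz; rewrite im0; lra.
by nra.
Qed.

Lemma offset_eq1 (R : realType) (z : C R) : branched_line z -> offset z = 1 ->
  z = 1 \/ z = - 1.
Proof.
move=> zS k1; have := branched_im zS; move: k1; rewrite /offset => k1 iz.
have im0 : im z = 0.
  have [//|re0|re1] := branched_cases zS; last by nra.
  by move: k1; rewrite re0 normr0; lra.
have : `|re z| = 1 by move: k1; rewrite im0; lra.
have [_ r1|_ r1] := ger0P (re z); [left|right]; apply: re_im_eq.
- by rewrite r1.
- by rewrite im0.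
- by rewrite -[LHS]opprK r1.
- by rewrite im0 /im /= oppr0.
Qed.

Lemma offset_branch_ptD (R : realType) (t : R) (m : int) :
  offset (branch_pt t + m%:~R) = `|m%:~R| * (1 + t).
Proof. by rewrite /offset reDz imDz /re /= add0r. Qed.

Lemma height_branch_pt (R : realType) (t : R) : height (branch_pt t) = t.
Proof. by rewrite /height /offset /re /im /= normr0 mul0r subr0. Qed.

(** * Maps of degree one *)

Lemma L1_int (R : realType) (F : C R -> C R) (z : C R) (m : int) :
  L1 F -> branched_line z -> F (z + m%:~R) = F z + m%:~R.
Proof.
move=> [_ _ F1] zS.
have nat_shift (w : C R) (n : nat) :
    branched_line w -> F (w + n%:Z%:~R) = F w + n%:Z%:~R.
  move=> wS; elim: n => [|n IH]; first by rewrite !addr0.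
  rewrite intS intrD mulr1z [1 + _]addrC !addrA F1 ?IH//.
  exact: branched_lineD.
case: m => n; first exact: nat_shift.
rewrite NegzE intrN; have := @nat_shift (z - n.+1%:Z%:~R) n.+1.
rewrite subrK => -> //; first by rewrite addrK.
by rewrite -intrN; exact: branched_lineD.
Qed.

Lemma L1_iter (R : realType) (F : C R -> C R) (z : C R) (n : nat) :
  L1 F -> branched_line z -> branched_line (iter n F z).
Proof. by move=> [FS _ _] zS; elim: n => //= n IH; exact: FS. Qed.

Lemma L1_comp_continuous (R : realType) (F : C R -> C R) (g : R -> C R) :
  L1 F -> continuous g -> (forall t, branched_line (g t)) -> continuous (F \o g).
Proof.
move=> [_ /subspace_continuousP Fc _] cg gS t P /(Fc _ (gS t)).
rewrite /= /within /= => near_P.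
have : \forall u \near t, branched_line (g u) -> P (F (g u)).
  exact: (cg t _ near_P).
by apply: filterS => u; apply.
Qed.

Lemma L1_translate (R : realType) (F : C R -> C R) (d : int) :
  L1 F -> L1 (fun z => F z + d%:~R).
Proof.
move=> [FS Fc F1]; split.
- by move=> z /FS; exact: branched_lineD.
- move=> z; apply: (@cvgD (C R) (C R) _ _ (nbhs_filter z) F (cst d%:~R)).
    exact: Fc.
  exact: cvg_cst.
- by move=> z /F1 ->; rewrite addrAC.
Qed.

Lemma iter_translate (R : realType) (F : C R -> C R) (d : int) (z : C R) (n : nat) :
    L1 F -> branched_line z ->
  iter n (fun w => F w + d%:~R) z = iter n F z + (d *+ n)%:~R.
Proof.
move=> FL zS; elim: n => [|n IH]; first by rewrite addr0.
by rewrite /= IH L1_int ?mulrSr ?intrD ?addrA//; exact: L1_iter.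
Qed.

Lemma Per_translate (R : realType) (F : C R -> C R) (d : int) (n : nat) :
  L1 F -> Per (fun w => F w + d%:~R) n -> Per F n.
Proof.
move=> FL [z zS [ret least]]; exists z => //.
have retE k : returns_mod1 (fun w => F w + d%:~R) z k <-> returns_mod1 F z k.
  split=> -[k0 [m zm]]; split => //.
    exists (m - d *+ k); rewrite intrB addrA -zm.
    by rewrite (iter_translate _ _ FL zS) addrK.
  by exists (m + d *+ k); rewrite (iter_translate _ _ FL zS) zm intrD addrA.
by split; [exact/retE|move=> k /retE; exact: least].
Qed.

(** * From a stretched segment of a branch to all periods *)

(** A period at least 2 is realized by a point that jumps by [G^2] from the upper
    part [[y, c]] of the segment to its lower part [[s, y]], where [y] is the
    last time at which the image has height [s]. The bound on [offset] says that
    before time [c] the image has not yet reached another branch; it excludes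
    that the point found for period 2 is already mapped by [G] to another of its
    integer translates. *)
Lemma Per_of_stretched_segment (R : realType) (G : C R -> C R) (s c : R) (n : nat) :
    L1 G -> 0 <= s -> s < c -> c <= 1 ->
    c <= height (G (branch_pt s)) -> height (G (branch_pt c)) < s ->
    height (G (G (branch_pt c))) <= s ->
    (forall t, s <= t < c -> offset (G (branch_pt t)) < 1) ->
  (0 < n)%N -> Per G n.
Proof.
move=> GL s0 sc c1 Gs Gc GGc small n0.
have clS (t : R) := branch_pt_clamp_in t.
have [GS _ _] := GL.
pose f t := height (G (branch_pt (clamp t))).
pose g t := height (G (G (branch_pt (clamp t)))).
have cG : continuous (G \o (fun t : R => branch_pt (clamp t))).
  exact: L1_comp_continuous GL (@branch_pt_clamp_continuous R) clS.
have cf : continuous f.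
  move=> t.
  apply: (@continuous_comp _ _ _
    (G \o (fun t : R => branch_pt (clamp t))) (@height R)).
    exact: cG.
  exact: height_continuous.
have cg : continuous g.
  move=> t.
  apply: (@continuous_comp _ _ _
    (G \o (G \o (fun t : R => branch_pt (clamp t)))) (@height R)).
    by apply: (L1_comp_continuous GL cG) => u; apply: GS.
  exact: height_continuous.
have fE t : 0 <= t <= 1 -> f t = height (G (branch_pt t)).
  by move=> t01; rewrite /f clampE.
have gE t : 0 <= t <= 1 -> g t = height (G (G (branch_pt t))).
  by move=> t01; rewrite /g clampE.
have Gf t : 0 <= t <= 1 -> 0 <= f t -> G (branch_pt t) = branch_pt (f t).
  by move=> t01; rewrite fE// => ft; apply: height_ge0 => //; apply/GS/branch_pt_in.
have Gg t : 0 <= t <= 1 -> 0 <= g t -> G (G (branch_pt t)) = branch_pt (g t).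
  by move=> t01; rewrite gE// => gt; apply: height_ge0 => //; apply/GS/GS/branch_pt_in.
have fs : c <= f s by rewrite fE//; lra.
have fc : f c < s by rewrite fE//; lra.
have gc : g c <= s by rewrite gE//; lra.
have [||||y [yin fy ylast]] := @last_hit R (fun t => - f t) s c (- s).
- by move=> t; apply: cvgN; exact: cf.
- by lra.
- by lra.
- by lra.
have {}fy : f y = s by apply: oppr_inj.
have {}ylast t : y < t <= c -> f t < s by move=> /ylast; lra.
have ys : y != s by apply: contraTneq fs => ys; rewrite -ltNge -ys fy; lra.
have yc : y != c by apply: contraTneq fc => <-; rewrite -leNgt fy.
have {}yin : s < y < c by lra.
have y01 : 0 <= y <= 1 by lra.
(* [G^2] sends the upper part across the whole segment: [y] goes to [G (i s)]. *)
have gy : c <= g y by rewrite gE// Gf ?fy// -fE//; lra.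
have branch_pt_inj t u (m : int) : branch_pt t = branch_pt u + m%:~R -> t = u.
  by move=> tu; have : im (branch_pt t) = u by rewrite tu imDz.
case: n n0 => // -[_|m _].
  have [|||||t tin tt] := @ivt R (fun t => f t - t) s y y s 0.
  - by move=> u; apply: cvgB; [exact: cf|exact: cvg_id].
  - by lra.
  - by lra.
  - by rewrite fy; lra.
  - by lra.
  have t01 : 0 <= t <= 1 by lra.
  exists (branch_pt t); first exact: branch_pt_in.
  split; last by move=> k [].
  split => //; exists 0; rewrite addr0 /= Gf//; last by lra.
  by congr branch_pt; lra.
have [|||||t [tin tloop tz]] := @loop_through R f g s y c m cf cg; try lra.
have t01 : 0 <= t <= 1 by lra.
have gt0 : 0 <= g t.
  by case: (m) tloop tz => [/= -> _|k _ /(_ 0%N isT) /=]; lra.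
(* The iterates of [f] stay nonnegative, so they are the heights of points of a
   true orbit of [G] on branch 0; only [G (i t)] itself may be off that branch. *)
have it k : (k <= m)%N -> iter k.+2 G (branch_pt t) = branch_pt (iter k f (g t)).
  elim: k => [_|k IH km]; first exact: Gg.
  rewrite [iter k.+3 _ _]iterS IH; last exact: ltnW.
  have fk := tz k km.
  rewrite Gf//=; first by lra.
  have [km'|mk] := ltnP k.+1 m; first by have := tz _ km'; rewrite /=; lra.
  have {mk}mE : m = k.+1 by apply/eqP; rewrite eqn_leq mk km.
  by move: tloop; rewrite mE /=; lra.
exists (branch_pt t); first exact: branch_pt_in.
split; first by split => //; exists 0; rewrite addr0 it// tloop.
move=> k [k0 [j kj]]; rewrite leqNgt; apply/negP => km.
(* For a period at least 3, an earlier return would force [i t] to be on the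
   lower part as well, hence [t = y];
   but [G^2] sends [y] to height at least [c], above the lower part. *)
have ty_false : (0 < m)%N -> t <= y -> False.
  move=> m0 ty; have {}ty : t = y by lra.
  by have := tz 0%N m0; rewrite /= ty; lra.
have [m0|m0] := posnP m; last first.
  apply: ty_false => //.
  case: k k0 km kj => [//|[|k]] _ km kj.
    (* A return after one step repeats itself, so the point returns after two. *)
    have Gt : G (G (branch_pt t)) = branch_pt t + (j + j)%:~R.
      move: kj => /= kj.
      by rewrite kj L1_int// ?kj ?intrD ?addrA//; exact: branch_pt_in.
    have := tz 0%N m0; rewrite /=; move: Gt; rewrite Gg// => /branch_pt_inj.
    by lra.
  have := kj; rewrite it; last by rewrite ltnW.
  by move=> /branch_pt_inj tE; have := tz k km; lra.
move: km kj tloop; rewrite m0 /=; case: k k0 => // -[|//] _ _ /= kj gt.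
(* For period 2 the point has to be shown not to return after one step: its
   image is not on another branch, and on branch 0 it would be a fixed point of
   [f], whereas [f < s] beyond [y]. *)
have tc : t != c by apply: contraTneq gt0 => tE; move: gc; rewrite -tE gt; lra.
have j0 : j = 0.
  have := small t; rewrite kj /offset reDz imDz add0r => j1.
  apply/eqP; rewrite -(@intr_eq0 R); apply: contraTT (j1 _) => [j0|]; last by lra.
  rewrite -leNgt.
  have : 1 <= `|j%:~R : R| by rewrite norm_intr_ge1// intr_int.
  by rewrite /im /=; nra.
have ft : f t = t.
  by rewrite fE// kj j0 addr0 /height /offset /re /im /= normr0 mul0r subr0.
have [ty|ty] := leP t y.
  have tE : t = y by lra.
  by move: ft; rewrite tE fy; lra.
by have := ylast t; lra.
Qed.

(** The proof shortens the segment so that the image of its end [c] becomes the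
    root 0 when [G 0] is not on branch 0 above its root, and one of the roots 1
    and -1 when [G 0] is there. In both cases the second image of the end has
    nonpositive height. *)
Lemma Per_of_crossing (R : realType) (G : C R -> C R) (s c h : R) (n : nat) :
    L1 G -> 0 <= s -> s < c -> c <= h -> c <= 1 ->
    G (branch_pt s) = branch_pt h -> 1 <= `|re (G (branch_pt c))| ->
  (0 < n)%N -> Per G n.
Proof.
move=> GL s0 sc ch c1 Gs Gc n0.
have clS (t : R) := branch_pt_clamp_in t.
have [GS _ _] := GL.
have cG : continuous (G \o (fun t : R => branch_pt (clamp t))).
  exact: L1_comp_continuous GL (@branch_pt_clamp_continuous R) clS.
have GcS : branched_line (G (branch_pt c)) by apply/GS/branch_pt_in; lra.
have imGc := branched_im GcS.
have kGc : 1 <= offset (G (branch_pt c)) by rewrite /offset; nra.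
have [G0|G0] := leP (height (G (branch_pt 0))) 0.
  (* The new end is the first time at which the image comes down to 0. *)
  have s_gt0 : 0 < s.
    rewrite lt_neqAle s0 andbT; apply: contraTneq G0 => s00.
    by rewrite s00 Gs height_branch_pt -ltNge; lra.
  pose f t := - height (G (branch_pt (clamp t))).
  have cf : continuous f.
    move=> t; apply: cvgN.
    apply: (@continuous_comp _ _ _
      (G \o (fun t : R => branch_pt (clamp t))) (@height R)).
      exact: cG.
    exact: height_continuous.
  have fE t : 0 <= t <= 1 -> f t = - height (G (branch_pt t)).
    by move=> t01; rewrite /f clampE.
  have [|||y [yin fy yfirst]] := @first_hit R f s c 0 cf; first by lra.
  - by rewrite fE ?Gs ?height_branch_pt; lra.
  - by rewrite fE ?/height; lra.
  have ys : y != s.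
    by apply: contra_eq_neq fy => ->; rewrite fE ?Gs ?height_branch_pt; lra.
  have y01 : 0 <= y <= 1 by lra.
  have Gy : height (G (branch_pt y)) = 0 by have := fE y y01; lra.
  have Gy0 : G (branch_pt y) = branch_pt 0.
    by rewrite [LHS]height_ge0 ?Gy//; exact/GS/branch_pt_in.
  apply: (@Per_of_stretched_segment R G s y) => //;
    rewrite ?Gs ?height_branch_pt ?Gy ?Gy0; try lra.
  move=> t tin; have t01 : 0 <= t <= 1 by lra.
  have := yfirst t tin; rewrite fE// oppr_lt0 => Gt.
  rewrite (height_ge0 _ (ltW Gt)); last exact/GS/branch_pt_in.
  by rewrite /offset /re /= normr0 mul0r.
have G0E : G (branch_pt 0) = branch_pt (height (G (branch_pt 0))).
  by apply: height_ge0; [apply/GS/branch_pt_in; lra|exact: ltW].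
(* The new end is the first time at which the image reaches 1 or -1. *)
pose f t := offset (G (branch_pt (clamp t))).
have cf : continuous f.
  move=> t.
  apply: (@continuous_comp _ _ _
    (G \o (fun t : R => branch_pt (clamp t))) (@offset R)).
    exact: cG.
  exact: offset_continuous.
have fE t : 0 <= t <= 1 -> f t = offset (G (branch_pt t)).
  by move=> t01; rewrite /f clampE.
have fs : f s = 0 by rewrite fE ?Gs /offset /re /= ?normr0 ?mul0r; lra.
have [|||y [yin fy yfirst]] := @first_hit R f s c 1 cf; first by lra.
- by rewrite fs.
- by rewrite fE; lra.
have ys : y != s by apply: contra_eq_neq fy => ->; rewrite fs; lra.
have y01 : 0 <= y <= 1 by lra.
have [m m1 Gy] : exists2 m : int,
    `|m%:~R| = 1 :> R & G (branch_pt y) = branch_pt 0 + m%:~R.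
  have GyS : branched_line (G (branch_pt y)) by exact/GS/branch_pt_in.
  have [|->|->] := offset_eq1 GyS; first by rewrite -fE.
  - by exists 1; rewrite ?normr1// add0r.
  - by exists (- 1); rewrite ?intrN ?normrN ?normr1// add0r.
have GGy : G (G (branch_pt y)) = branch_pt (height (G (branch_pt 0))) + m%:~R.
  by rewrite -G0E Gy L1_int//; apply: branch_pt_in; lra.
apply: (@Per_of_stretched_segment R G s y) => //.
- by lra.
- by lra.
- by rewrite Gs height_branch_pt; lra.
- by rewrite Gy /height offset_branch_ptD imDz /im /= m1; lra.
- by rewrite GGy /height offset_branch_ptD imDz /im /= m1; lra.
- by move=> t tin; rewrite -fE; [exact: yfirst|lra].
Qed.

(** * Displacements along a large orbit *)

Lemma finite_argmin (R : realType) (T : finType) (P : pred T) (x : T -> R) (i0 : T) :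
  P i0 -> exists2 i, P i & forall j, P j -> x i <= x j.
Proof.
by move=> Pi0; case: (Order.TotalTheory.arg_minP x Pi0) => i Pi imin; exists i.
Qed.

(** Among the indices with [d l != d i], where [x i] is the least value, take one
    with [x l] least. All values below [x l] then carry the displacement [d i],
    and the sequence has to climb from [x i] to [x l] past some of them. *)
Lemma crossing_index (R : realType) (k : nat) (x : nat -> R) (d : nat -> int) :
    (0 < k)%N -> (forall n, x (n %% k)%N = x n) ->
    (forall n l, x n = x l -> d n = d l) -> (exists l, d l != d 0%N) ->
  exists j l, [/\ x j < x l, x l <= x j.+1 & d l != d j].
Proof.
move=> k0 xmod dx [l1 l1d].
have dmod n : d (n %% k)%N = d n by apply: dx.
have [i _ imin] := @finite_argmin R 'I_k predT (fun i => x i) (Ordinal k0) isT.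
have [l0 l0d] : exists l, d l != d i.
  have [d1|] := eqVneq (d l1) (d i); last by exists l1.
  by exists 0%N; rewrite eq_sym -d1.
have [|l ld lmin] := @finite_argmin R 'I_k (fun l => d l != d i) (fun l => x l)
    (Ordinal (ltn_pmod l0 k0)).
  by rewrite /= dmod.
have il : x i < x l.
  rewrite lt_neqAle imin// andbT; apply: contra_neq ld => xx.
  by rewrite (dx _ _ xx).
have [j [jl lj]] : exists j, x j < x l /\ x l <= x j.+1.
  apply: contrapT => /forallNP nocross.
  have below q : x (i + q)%N < x l.
    elim: q => [|q IH]; first by rewrite addn0.
    rewrite addnS ltNge; apply/negP => lq.
    by apply: (nocross (i + q)%N).
  (* Since [x] has period [k], going [k - i + l] steps from [i] leads to [l]. *)
  have := below (k - i + l)%N.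
  by rewrite addnA subnKC ?[(i <= k)%N]ltnW// -xmod modnDl xmod ltxx.
have dj : d j = d i.
  apply/eqP; apply: contraTT jl => jd; rewrite -leNgt -(xmod j).
  by apply: (lmin (Ordinal (ltn_pmod j k0))); rewrite /= dmod.
by exists j, l; rewrite dj.
Qed.

(** With all displacements equal to [d], a period [k] gives [d * k = 0], so the
    orbit stays on one branch and has real diameter 0. *)
Lemma large_orbit_crossing (R : realType) (F : C R -> C R) (Q : set (C R)) :
    L1 F -> large_orbit F Q -> Q `<=` @branches R ->
  exists (s c h : R) (d e : int), [/\ 0 <= s < c, c <= h, c <= 1,
    F (branch_pt s) = branch_pt h + d%:~R &
    e <> d /\ re (F (branch_pt c)) = e%:~R].
Proof.
move=> FL [[z0 [z0S [k k0 zk] QE]] large] Qbranch.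
pose z n := iter n F z0.
have zQ n : branches (z n) by apply: Qbranch; rewrite QE; exists n.
have zB n : branched_line (z n) by right.
pose x n := im (z n).
pose m n : int := Num.floor (re (z n)).
have mE n : (m n)%:~R = re (z n) :> R.
  by apply/eqP; rewrite -intrEfloor; case: (zQ n).
have x01 n : 0 <= x n <= 1 by case: (zQ n).
have zE n : z n = branch_pt (x n) + (m n)%:~R.
  by apply: re_im_eq; rewrite ?reDz ?imDz// mE /re /= add0r.
pose d n := m n.+1 - m n.
have Fx n : F (branch_pt (x n)) = branch_pt (x n.+1) + (d n)%:~R.
  have : F (branch_pt (x n) + (m n)%:~R) = z n.+1 by rewrite -zE.
  rewrite L1_int//; last exact: branch_pt_in.
  rewrite zE => Fz; rewrite /d intrB addrA -Fz addrK//.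
have reFx n : re (F (branch_pt (x n))) = (d n)%:~R by rewrite Fx reDz /re /= add0r.
have dx n l : x n = x l -> d n = d l.
  by move=> xx; apply/eqP; rewrite -(eqr_int R) -!reFx xx.
have zmod n : z (n %% k)%N = z n.
  rewrite {2}(divn_eq n k) addnC /z iterD; congr iter.
  by elim: (n %/ k)%N => [|q IH] //; rewrite mulSn iterD -IH zk.
have xmod n : x (n %% k)%N = x n by rewrite /x zmod.
have dvar : exists l : nat, d l != d 0%N.
  apply: contrapT => /forallNP all_d.
  have dE n : d n = d 0%N by apply/eqP/negPn/negP; exact: all_d.
  have mn n : m n = m 0%N + d 0%N *+ n.
    elim: n => [|n IH]; first by rewrite addr0.
    by rewrite mulrSr addrA -IH -(dE n) /d addrCA subrr addr0.
  have di0 : d 0%N = 0.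
    have := mn k; rewrite {1}/m /z zk => /eqP.
    rewrite addrC -subr_eq subrr eq_sym mulrn_eq0 => /orP[|/eqP//].
    by rewrite eqn0Ngt k0.
  have reE w : Q w -> re w = (m 0%N)%:~R.
    by rewrite QE => -[n _ <-]; rewrite -/(z n) -mE mn di0 mul0rn addr0.
  move: large; apply/negP; rewrite -ltNge.
  apply: (@le_lt_trans _ _ 0%E); last by rewrite lte_fin.
  apply: ge_ereal_sup => _ [_ [u Qu <-] [_ [v Qv <-] <-]].
  by rewrite (reE u Qu) (reE v Qv) subrr normr0.
have [j [l [jl lj ld]]] := crossing_index k0 xmod dx dvar.
exists (x j), (x l), (x j.+1), (d j), (d l); split=> //.
- by have := x01 j; lra.
- by have := x01 l; lra.
- by split; [exact/eqP|exact: reFx].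
Qed.

Theorem theorem6 (R : realType) (F : C R -> C R)
    (Q : set (C R)) :
  L1 F -> large_orbit F Q -> Q `<=` @branches R ->
  Per F = [set n : nat | (0 < n)%N].
Proof.
move=> FL large Qbranch; apply/seteqP; split => [n [z _ [[n0 _] _]] //|n /= n0].
have [s [c [h [d [e [/andP[s0 sc] ch c1 Fs [ed Fc]]]]]]] :=
  large_orbit_crossing FL large Qbranch.
apply: (@Per_translate R F (- d)) => //.
apply: (@Per_of_crossing R _ s c h n (L1_translate _ FL) s0 sc ch c1) => //.
- by rewrite Fs intrN addrK.
- rewrite reDz Fc -intrD norm_intr_ge1 ?intr_int// intr_eq0 subr_eq0.
  exact/eqP.
Qed.
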